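(* Let $G$ be a simple connected graph with $N_0^k$ vertices and $E_0^k\ge1$ edges, and let $k\ge2$, $n\ge1$ be integers. The Kemeny's constant of the $n$-th $k$-hexagonal graph $H^k_n(G)$ satisfies $$K(H^k_n(G))=\frac{25k+5}{k+5}K(H^k_{n-1}(G))+\left[\frac{8k(5k+21)}{5(k+5)}(5k+1)^{n-1}+\frac{32k}{5(k+5)}\right]E_0^k-\frac{8k}{k+5}N_0^k+\frac{4(5k^2-23k)}{(k+5)(5k+1)},$$ and in general $$K(H^k_n(G))=\left(\frac{25k+5}{k+5}\right)^nK(G)+\left[\frac{8k(5k+21)\eta}{5(k+5)}(5k+1)^{n-1}+\frac{32k\mu}{5(k+5)}\right]E_0^k-\frac{8k\mu}{k+5}N_0^k+\frac{4(5k^2-23k)\mu}{(k+5)(5k+1)},$$ where $$\mu=\frac{k+5}{24k}\left\{\left[\frac{5(5k+1)}{k+5}\right]^n-1\right\},\qquad \eta=-\frac{k+5}{k}\left\{\left[\frac5{k+5}\right]^n-1\right\}.$$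
   Context: Graphs are finite, simple and connected. The superscript $k$ in $N_0^k$, $E_0^k$ is an index, not a power: these are simply the order and size of $H^k_0(G)=G$. The $k$-hexagonal graph $H^k(G)$ of $G$ is obtained by replacing each edge $uv$ of $G$ by $k+1$ internally disjoint $u$–$v$ paths, one of length $1$ (the edge $uv$ itself) and $k$ of length $5$ (each with 4 new internal vertices). Set $H^k_0(G)=G$ and $H^k_n(G)=H^k(H^k_{n-1}(G))$ for $n\ge1$. The normalized Laplacian of a graph with adjacency matrix $A$ and diagonal degree matrix $D$ is $\mathcal{L}=I-D^{-1/2}AD^{-1/2}$. For a connected graph $F$ with $N$ vertices and normalized Laplacian eigenvalues $0=\lambda_1<\lambda_2\le\cdots\le\lambda_N$ (with multiplicity), the Kemeny's constant is $K(F)=\sum_{i=2}^{N}\frac1{\lambda_i}$. *)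

(* Defs.v *)
From mathcomp Require Import all_boot all_order all_algebra.
From mathcomp Require Import polyrcf.

Set Implicit Arguments.
Unset Strict Implicit.
Unset Printing Implicit Defensive.

Import Order.TTheory GRing.Theory Num.Theory.
Local Open Scope ring_scope.

Record sgraph := SGraph {
  vertex :> finType;
  adj : rel vertex;
  adj_sym : symmetric adj;
  adj_irr : irreflexive adj }.

Definition edges (G : sgraph) : {set {set G}} :=
  [set [set p.1; p.2] | p in [pred p : G * G | adj p.1 p.2]].

Definition degree (G : sgraph) (u : G) : nat := #|[set v | adj u v]|.

Definition connected (G : sgraph) : Prop := forall u v : G, connect (@adj G) u v.

(* An edge uv carries two darts, (u, v) and (v, u). *)
Definition dart (G : sgraph) := {p : G * G | adj p.1 p.2}.

Definition is_rev (G : sgraph) (d d' : dart G) : bool :=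
  val d' == ((val d).2, (val d).1).

Section Hexagonal.
Variables (k : nat) (G : sgraph).

(* The i-th new u-v path (i < k) attached to an edge uv is                    *)
(*   u, (uv, i, false), (uv, i, true), (vu, i, true), (vu, i, false), v       *)
(* so that no orientation of the edges of G has to be chosen.                 *)
Definition hex_vertex : finType := (G + (dart G * 'I_k * bool))%type.

Definition hex_adj (x y : hex_vertex) : bool :=
  match x, y with
  | inl u, inl v => adj u v
  | inl u, inr (d, _, b) | inr (d, _, b), inl u => ~~ b && ((val d).1 == u)
  | inr (d, i, b), inr (d', i', b') =>
      (i == i') && ((d == d') && (b != b') || [&& b, b' & is_rev d d'])
  end.

Lemma is_revC (d d' : dart G) : is_rev d d' = is_rev d' d.
Proof.
rewrite /is_rev; case: (val d) (val d') => [a b] [c e] /=.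
by rewrite !xpair_eqE andbC (eq_sym c b) (eq_sym e a).
Qed.

Lemma hex_adj_sym : symmetric hex_adj.
Proof.
move=> [u|[[d i] b]] [v|[[d' i'] b']] //=; first exact: adj_sym.
by rewrite is_revC (eq_sym i) (eq_sym d) (eq_sym b) andbCA.
Qed.

Lemma hex_adj_irr : irreflexive hex_adj.
Proof.
move=> [u|[[d i] b]] /=; first exact: adj_irr.
rewrite !eqxx /=; apply/negP => /and3P[_ _]; rewrite /is_rev.
case: d => -[u v] /= uv; rewrite xpair_eqE => /andP[/eqP uv_eq _].
by rewrite uv_eq adj_irr in uv.
Qed.

Definition hexagonal : sgraph := SGraph hex_adj_sym hex_adj_irr.

End Hexagonal.

Definition hexagonal_iter (k n : nat) (G : sgraph) : sgraph :=
  iter n (hexagonal k) G.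

Section Kemeny.
Variable R : rcfType.

Definition adj_mx (G : sgraph) : 'M[R]_#|G| :=
  \matrix_(i, j) (adj (enum_val i) (enum_val j))%:R.

Definition deg_inv_sqrt_mx (G : sgraph) : 'M[R]_#|G| :=
  diag_mx (\row_i (Num.sqrt (degree (enum_val i))%:R)^-1).

Definition norm_laplacian (G : sgraph) : 'M[R]_#|G| :=
  1%:M - deg_inv_sqrt_mx G *m adj_mx G *m deg_inv_sqrt_mx G.

(* Real eigenvalues in increasing order, each repeated according to its       *)
(* multiplicity as a root of the characteristic polynomial; for a symmetric   *)
(* matrix such as the normalized Laplacian these are all m eigenvalues.       *)
Definition eigenvalues (m : nat) (A : 'M[R]_m) : seq R :=
  sort <=%R (flatten [seq nseq (mup x (char_poly A)) x
                        | x <- rootsR (char_poly A)]).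

(* Indices start at 0: the sum leaves out exactly the least eigenvalue. *)
Definition kemeny (G : sgraph) : R :=
  \sum_(1 <= i < #|G|) ((eigenvalues (norm_laplacian G))`_i)^-1.

End Kemeny.

(* Main.v *)
Require Import Defs.
From mathcomp Require Import all_boot all_order all_algebra spectral.
From mathcomp Require Import polyrcf complex ring.
Import Order.TTheory GRing.Theory Num.Theory.
Local Open Scope ring_scope.

Set Implicit Arguments.
Unset Strict Implicit.
Unset Printing Implicit Defensive.

(** Let [L = D - A] be the combinatorial Laplacian of a connected graph [G] with
    [E] edges, [d] its vector of degrees and [2 E] its volume.  The proof rests
    on an expression of Kemeny's constant that needs no eigenvalue: for every
    matrix [S] such that [L S L = L],

      [K(G) = tr (D S) - (d^T S d) / (2 E)]        ([kemeny_ginv]).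

    Indeed the normalized Laplacian is [D^-1/2 L D^-1/2]; it is symmetric and
    positive semidefinite, and its kernel is spanned by [D^1/2 1], so the sum of
    the inverses of its nonzero eigenvalues is the trace of any generalized
    inverse, here [D^1/2 S D^1/2], cut down to the orthogonal complement of that
    kernel ([sum_inv_eigenvalues]).

    For [H = H^k(G)] a generalized inverse comes from block elimination of the
    new vertices.  Let [T] extend a function on the vertices of [G] to those of
    [H] by linear interpolation along each new path, let [J] extend it by zero,
    and let [Gamma] be the Green function of the new paths with both ends
    grounded.  A path of five unit resistors has conductance 1/5, whence

      [L_H T = (1 + k/5) J L]      and      [L_H Gamma = 1 - J T^T],

    and these two identities make [Gamma + (1 + k/5)^-1 T S T^T] a generalized
    inverse of [L_H] whenever [S] is one of [L] ([ginv_hex]).  Inserting it in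
    the formula above leaves traces along a single path,

      [tr (D_H Gamma) = 8 k E],         [d_H^T Gamma d_H = 40 k E],
      [T^T d_H = (5 k + 1) d],
      [T^T D_H T = (5 k + 1) D - (8 k / 5) L],

    and the trace of [L S], which is the rank [N - 1] of [L].  The result is

      [K(H) = 5 (5 k + 1) / (k + 5) K(G) + 8 k E - 8 k (N - 1) / (k + 5)
              - 20 k / (5 k + 1)]        ([kemeny_hex]).

    The first formula of the theorem is this one for the [(n - 1)]-st iterate,
    whose order and size are geometric in [n]; the second follows from the first
    by induction on [n]. *)

(** * Inverse eigenvalues of a symmetric matrix *)

Local Notation toC := (real_complex _).

Lemma mup_prod_XsubC (F : fieldType) (s : seq F) (x : F) :
  mup x (\prod_(a <- s) ('X - a%:P)) = count_mem x s.
Proof.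
elim: s => [|a s IHs]; first by rewrite big_nil mupNroot // root1.
rewrite big_cons mupM ?polyXsubC_eq0 // ?IHs /=.
  by rewrite -['X - a%:P]expr1 mup_XsubCX; case: (a == x).
by rewrite monic_neq0 // monic_prod_XsubC.
Qed.

Lemma perm_eigenvalues (R : rcfType) (n : nat) (A : 'M[R]_n) (s : seq R) :
  char_poly A = \prod_(a <- s) ('X - a%:P) -> perm_eq (eigenvalues A) s.
Proof.
move=> cpA; rewrite /eigenvalues perm_sort.
have cpA0 : char_poly A != 0 by rewrite monic_neq0 // char_poly_monic.
rewrite -(permPr (perm_count_undup s)) cpA.
under eq_map do rewrite mup_prod_XsubC.
apply/perm_flatten/perm_map/uniq_perm; rewrite ?undup_uniq ?uniq_roots //.
move=> x; rewrite mem_undup -cpA -(roots_on_rootsR cpA0) /= cpA.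
by rewrite root_prod_XsubC.
Qed.

Lemma char_poly_conj (F : fieldType) (n : nat) (P D : 'M[F]_n) :
  P \in unitmx -> char_poly (invmx P *m D *m P) = char_poly D.
Proof.
move=> Pu; rewrite /char_poly /char_poly_mx.
have Q1 : map_mx polyC (invmx P) *m map_mx polyC P = 1%:M.
  by rewrite -map_mxM mulVmx // map_mx1.
have -> : 'X%:M - map_mx polyC (invmx P *m D *m P)
  = map_mx polyC (invmx P) *m ('X%:M - map_mx polyC D) *m map_mx polyC P.
  by rewrite mulmxBr mulmxBl !map_mxM; congr (_ - _);
     rewrite scalar_mxC -mulmxA Q1 mulmx1.
by rewrite !det_mulmx mulrC mulrA [_ * \det (map_mx _ (invmx P))]mulrC
           -det_mulmx Q1 det1 mul1r.
Qed.

(** The unitary spectral theorem lives over [R[i]]; the complex [P] is harmless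
    because only traces are drawn from it, and these descend to [R]. *)
Lemma symmetric_diagonalizable (R : rcfType) (n : nat) (A : 'M[R]_n) :
  A^T = A ->
  exists P : 'M[R[i]]_n, exists d : 'rV[R]_n, P \in unitmx /\
    map_mx toC A
      = invmx P *m diag_mx (map_mx toC d) *m P.
Proof.
move=> symA; set Ac := map_mx _ A.
have Acherm : Ac \is hermsymmx.
  apply: realsym_hermsym; first apply/is_hermitianmxP.
    by rewrite expr0 scale1r map_mx_id // map_trmx symA.
  by apply/mxOverP=> i j; rewrite mxE complex_real.
exists (spectralmx Ac), (\row_i complex.Re (spectral_diag Ac 0 i)).
split; first exact: spectral_unit.
have -> : map_mx toC (\row_i complex.Re (spectral_diag Ac 0 i))
    = spectral_diag Ac.
  apply/rowP=> i; rewrite !mxE RRe_real //.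
  by have /mxOverP := hermitian_spectral_diag_real Acherm.
exact/orthomx_spectralP/hermitian_normalmx.
Qed.

Lemma eigenvalues_ge0 (R : rcfType) (n : nat) (A : 'M[R]_n) :
  (forall v : 'rV_n, 0 <= (v *m A *m v^T) 0 0) ->
  {in eigenvalues A, forall x, 0 <= x}.
Proof.
move=> psdA x; rewrite mem_sort => /flattenP[_ /mapP[y yA ->]].
rewrite mem_nseq => /andP[_ /eqP->] {x}.
have cpA0 : char_poly A != 0 by rewrite monic_neq0 // char_poly_monic.
move: yA; rewrite -(roots_on_rootsR cpA0) => /andP[_].
rewrite -eigenvalue_root_char => /eigenvalueP[v vA v0].
have := psdA v; rewrite vA -scalemxAl mxE.
suff vv : 0 < (v *m v^T) 0 0 by rewrite pmulr_lge0.
rewrite mxE; have [i vi] : exists i, v 0 i != 0.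
  apply/existsP; apply: contraNT v0 => /existsPn v0.
  by apply/eqP/rowP => i; rewrite mxE; apply/eqP; have := v0 i; rewrite negbK.
rewrite (bigD1 i) //= ltr_wpDr //; last by rewrite mxE -expr2 exprn_even_gt0.
by apply: sumr_ge0 => j _; rewrite mxE -expr2 sqr_ge0.
Qed.

(** Inverting the nonzero entries of the diagonal form gives the group inverse,
    whose trace is the sum of the inverse nonzero eigenvalues since
    [0^-1 = 0]. *)
Lemma diagonalizable_group_inverse (F : fieldType) (n : nat) (A P : 'M[F]_n)
    (d : 'rV[F]_n) :
  P \in unitmx -> A = invmx P *m diag_mx d *m P ->
  exists B : 'M[F]_n, [/\ A *m B = B *m A, A *m B *m A = A, B *m A *m B = B
    & \tr B = \sum_i (d 0 i)^-1].
Proof.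
move=> Pu AE; pose B := invmx P *m diag_mx (\row_i (d 0 i)^-1) *m P.
have conjM (u v : 'rV[F]_n) :
  (invmx P *m diag_mx u *m P) *m (invmx P *m diag_mx v *m P)
  = invmx P *m diag_mx (\row_i (u 0 i * v 0 i)) *m P.
  by rewrite !mulmxA mulmxK // -[invmx P *m _ *m _]mulmxA mulmx_diag.
exists B; rewrite {}AE /B !conjM; split.
- by congr (_ *m diag_mx _ *m _); apply/rowP=> i; rewrite !mxE mulrC.
- congr (_ *m diag_mx _ *m _); apply/rowP=> i; rewrite !mxE.
  have [->|di0] := eqVneq (d 0 i) 0; first by rewrite mulr0.
  by rewrite mulfV // mul1r.
- congr (_ *m diag_mx _ *m _); apply/rowP=> i; rewrite !mxE.
  have [->|di0] := eqVneq (d 0 i) 0; first by rewrite invr0 mulr0.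
  by rewrite mulVf // mul1r.
- rewrite mxtrace_mulC mulmxA mulmxV // mul1mx mxtrace_diag.
  by apply: eq_bigr => i _; rewrite mxE.
Qed.

(** The hypotheses on [Q] make it the projection onto the kernel of [A] along
    its image, so that [1 - Q = A B], and the trace of [Y A B] can be cycled
    until [Y] is sandwiched between two copies of [A]. *)
Lemma mxtrace_ginv (F : fieldType) (n : nat) (A B Y Q W : 'M[F]_n) :
  A *m B = B *m A -> A *m B *m A = A -> B *m A *m B = B ->
  A *m Y *m A = A -> A *m Q = 0 -> 1%:M - Q = A *m W ->
  \tr (Y *m (1%:M - Q)) = \tr B.
Proof.
move=> AB ABA BAB AYA AQ QW.
have -> : 1%:M - Q = A *m B.
  have -> : 1%:M - Q = A *m B *m (1%:M - Q) by rewrite QW mulmxA ABA.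
  by rewrite mulmxBr mulmx1 {2}AB -mulmxA AQ mulmx0 subr0.
have AYABB : A *m Y *m A *m B *m B = B by rewrite AYA AB BAB.
rewrite -[in RHS]AYABB -!mulmxA [in RHS]mxtrace_mulC -!mulmxA.
by rewrite -AB (mulmxA B A) BAB.
Qed.

(** The list of eigenvalues is sorted and nonnegative and contains 0, so its
    item of index 0 is 0 and contributes [0^-1 = 0]: the sum from index 1 is the
    sum over the whole spectrum. *)
Lemma sum_inv_eigenvalues (R : rcfType) (n : nat) (A Y Q W : 'M[R]_n) :
  A^T = A -> (forall v : 'rV_n, 0 <= (v *m A *m v^T) 0 0) -> eigenvalue A 0 ->
  A *m Y *m A = A -> A *m Q = 0 -> 1%:M - Q = A *m W ->
  \sum_(1 <= i < n) ((eigenvalues A)`_i)^-1 = \tr (Y *m (1%:M - Q)).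
Proof.
move=> symA psdA A0 AYA AQ QW.
have [P [d [Pu AE]]] := symmetric_diagonalizable symA.
have cpA : char_poly A = \prod_(a <- [seq d 0 i | i <- enum 'I_n]) ('X - a%:P).
  apply: (map_poly_inj toC).
  rewrite map_char_poly AE char_poly_conj // char_poly_trig ?diag_mx_is_trig //.
  rewrite big_map big_enum /= rmorph_prod; apply: eq_bigr => i _.
  by rewrite !mxE eqxx mulr1n rmorphB /= map_polyX map_polyC.
have eigA := perm_eigenvalues cpA; set s := eigenvalues A in eigA *.
have sizes : size s = n by rewrite (perm_size eigA) size_map size_enum_ord.
have s0 : 0 \in s.
  rewrite (perm_mem eigA) -root_prod_XsubC -cpA -eigenvalue_root_char //.
have sumE : \sum_(1 <= i < n) (s`_i)^-1 = \sum_i (d 0 i)^-1.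
  have -> : \sum_i (d 0 i)^-1 = \sum_(x <- s) x^-1.
    by rewrite (perm_big _ eigA) big_map big_enum.
  have n_gt0 : (0 < n)%N by rewrite -sizes; case: (s) s0.
  rewrite [RHS](big_nth 0) sizes [RHS]big_ltn //.
  suff -> : s`_0 = 0 by rewrite invr0 add0r.
  apply/eqP; rewrite eq_le (eigenvalues_ge0 psdA) ?mem_nth ?sizes // andbT.
  have /(nthP 0)[j js sj0] := s0; rewrite -[leRHS]sj0.
  have srt : sorted <=%R s by apply: sort_sorted; apply: le_total.
  by apply: (sorted_leq_nth le_trans le_refl 0 srt) => //; rewrite inE ?sizes.
have [B [AB ABA BAB trB]] := diagonalizable_group_inverse Pu AE.
rewrite sumE; apply: (@complexI R).
have -> : (\sum_i (d 0 i)^-1)%:C%C = \tr B.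
  by rewrite trB rmorph_sum; apply: eq_bigr => i _; rewrite mxE fmorphV.
rewrite -trace_map_mx map_mxM map_mxB map_mx1; apply/esym.
apply: (mxtrace_ginv (W := map_mx toC W) AB ABA BAB).
- by rewrite -!map_mxM AYA.
- by rewrite -map_mxM AQ map_mx0.
- by rewrite -map_mxM -QW map_mxB map_mx1.
Qed.

(** * Matrices indexed by finite types *)

Section FinTypeMatrices.
Variable R : comNzRingType.

(** Matrices over vertex sets are entered as functions of two vertices, so that
    their products are computed as sums over vertices rather than over the
    ordinals that index the rows. *)
Definition kmx (T1 T2 : finType) (F : T1 -> T2 -> R) : 'M[R]_(#|T1|, #|T2|) :=
  \matrix_(i, j) F (enum_val i) (enum_val j).

Definition kcol (T : finType) (f : T -> R) : 'cV[R]_#|T| :=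
  \col_i f (enum_val i).

Lemma sum_enum_val (T : finType) (f : T -> R) :
  \sum_(i < #|T|) f (enum_val i) = \sum_x f x.
Proof. by rewrite -big_enum_val. Qed.

Lemma eq_kmx (T1 T2 : finType) (F G : T1 -> T2 -> R) :
  F =2 G -> kmx F = kmx G.
Proof. by move=> FG; apply/matrixP=> i j; rewrite !mxE FG. Qed.

Lemma eq_kcol (T : finType) (f g : T -> R) : f =1 g -> kcol f = kcol g.
Proof. by move=> fg; apply/colP=> i; rewrite !mxE fg. Qed.

Lemma kcolE (T : finType) (v : 'cV[R]_#|T|) :
  v = kcol (fun x => v (enum_rank x) 0).
Proof. by apply/colP=> i; rewrite mxE enum_valK. Qed.

Lemma mul_kmx (T1 T2 T3 : finType) (F : T1 -> T2 -> R) (G : T2 -> T3 -> R) :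
  kmx F *m kmx G = kmx (fun x z => \sum_y F x y * G y z).
Proof.
apply/matrixP=> i j; rewrite !mxE -[RHS]sum_enum_val.
by apply: eq_bigr => l _; rewrite !mxE.
Qed.

Lemma mul_kmx_col (T1 T2 : finType) (F : T1 -> T2 -> R) (f : T2 -> R) :
  kmx F *m kcol f = kcol (fun x => \sum_y F x y * f y).
Proof.
apply/colP=> i; rewrite !mxE -[RHS]sum_enum_val.
by apply: eq_bigr => l _; rewrite !mxE.
Qed.

Lemma mul_kcol_tr (T : finType) (f g : T -> R) :
  ((kcol f)^T *m kcol g) 0 0 = \sum_x f x * g x.
Proof.
rewrite !mxE -[RHS]sum_enum_val.
by apply: eq_bigr => l _; rewrite !mxE.
Qed.

Lemma tr_kmx (T1 T2 : finType) (F : T1 -> T2 -> R) :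
  (kmx F)^T = kmx (fun y x => F x y).
Proof. by apply/matrixP=> i j; rewrite !mxE. Qed.

Lemma mxtrace_kmx (T : finType) (F : T -> T -> R) :
  \tr (kmx F) = \sum_x F x x.
Proof.
by rewrite /mxtrace -[RHS]sum_enum_val; apply: eq_bigr => i _; rewrite mxE.
Qed.

Lemma kmx1 (T : finType) : kmx (fun x y : T => (x == y)%:R) = 1%:M.
Proof. by apply/matrixP=> i j; rewrite !mxE (inj_eq enum_val_inj). Qed.

Lemma kmxB (T1 T2 : finType) (F G : T1 -> T2 -> R) :
  kmx F - kmx G = kmx (fun x y => F x y - G x y).
Proof. by apply/matrixP=> i j; rewrite !mxE. Qed.

Lemma kmxZ (T1 T2 : finType) (c : R) (F : T1 -> T2 -> R) :
  c *: kmx F = kmx (fun x y => c * F x y).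
Proof. by apply/matrixP=> i j; rewrite !mxE. Qed.

Lemma kcolZ (T : finType) (c : R) (f : T -> R) :
  c *: kcol f = kcol (fun x => c * f x).
Proof. by apply/matrixP=> i j; rewrite !mxE. Qed.

Lemma sum_delta (T : finType) (x : T) (f : T -> R) :
  \sum_y (x == y)%:R * f y = f x.
Proof.
rewrite (bigD1 x) //= eqxx mul1r big1 ?addr0 // => y /negPf xy.
by rewrite eq_sym xy mul0r.
Qed.

Lemma sum_deltar (T : finType) (x : T) (f : T -> R) :
  \sum_y f y * (y == x)%:R = f x.
Proof.
rewrite -[RHS](sum_delta x); apply: eq_bigr => y _.
by rewrite mulrC eq_sym.
Qed.

Lemma sum_natl (T : finType) (P : pred T) (x : T) (F : T -> R) :
  (forall y, P y = (y == x)) -> \sum_y (P y)%:R * F y = F x.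
Proof.
move=> Px; rewrite -[RHS](sum_delta x).
by apply: eq_bigr => y _; rewrite Px eq_sym.
Qed.

Definition kdiag (T : finType) (f : T -> R) : 'M[R]_#|T| :=
  kmx (fun x y => (x == y)%:R * f x).

Lemma mul_kdiag_l (T1 T2 : finType) (f : T1 -> R) (F : T1 -> T2 -> R) :
  kdiag f *m kmx F = kmx (fun x y => f x * F x y).
Proof.
rewrite mul_kmx; apply: eq_kmx => x y.
by under eq_bigr do rewrite -mulrA; rewrite sum_delta.
Qed.

Lemma kdiag_tr (T : finType) (f : T -> R) : (kdiag f)^T = kdiag f.
Proof.
rewrite tr_kmx; apply: eq_kmx => x y; rewrite eq_sym.
by case: eqP => [->|]//; rewrite !mul0r.
Qed.

Lemma mul_kdiag_col (T : finType) (f g : T -> R) :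
  kdiag f *m kcol g = kcol (fun x => f x * g x).
Proof.
rewrite mul_kmx_col; apply: eq_kcol => x.
by under eq_bigr do rewrite -mulrA; rewrite sum_delta.
Qed.

Lemma kdiagM (T : finType) (f g : T -> R) :
  kdiag f *m kdiag g = kdiag (fun x => f x * g x).
Proof. by rewrite mul_kdiag_l; apply: eq_kmx => x y; rewrite mulrCA. Qed.

Lemma kdiag1 (T : finType) (f : T -> R) : f =1 (fun=> 1) -> kdiag f = 1%:M.
Proof. by move=> f1; rewrite -kmx1; apply: eq_kmx => x y; rewrite f1 mulr1. Qed.

End FinTypeMatrices.

(** * The Laplacian of a graph and its generalized inverses *)

Section Graph.
Variable R : rcfType.
Implicit Types G : sgraph.

Definition deg G (u : G) : R := (degree u)%:R.

Definition degmx G : 'M[R]_#|G| := kdiag (@deg G).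

Definition lapmx G : 'M[R]_#|G| :=
  kmx (fun u v => (u == v)%:R * deg u - (adj u v)%:R).

Lemma degE G (u : G) : deg u = \sum_v (adj u v)%:R.
Proof.
rewrite /deg /degree -sum1_card natr_sum big_mkcond /=.
by apply: eq_bigr => v _; rewrite inE; case: ifP.
Qed.

Lemma lapmx_tr G : (lapmx G)^T = lapmx G.
Proof.
rewrite tr_kmx; apply: eq_kmx => u v; rewrite adj_sym eq_sym.
by case: eqP => [->|_] //; rewrite !mul0r.
Qed.

Lemma lap_sum G (u : G) (f : G -> R) :
  \sum_v ((u == v)%:R * deg u - (adj u v)%:R) * f v
  = \sum_v (adj u v)%:R * (f u - f v).
Proof.
under eq_bigr do rewrite mulrBl -mulrA.
rewrite sumrB sum_delta degE mulr_suml -sumrB.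
by apply: eq_bigr => v _; rewrite mulrBr.
Qed.

Lemma mul_lapmx G (T : finType) (F : G -> T -> R) :
  lapmx G *m kmx F = kmx (fun u w => \sum_v (adj u v)%:R * (F u w - F v w)).
Proof. by rewrite mul_kmx; apply: eq_kmx => u w; rewrite lap_sum. Qed.

Lemma mul_lapmx_col G (f : G -> R) :
  lapmx G *m kcol f = kcol (fun u => \sum_v (adj u v)%:R * (f u - f v)).
Proof. by rewrite mul_kmx_col; apply: eq_kcol => u; rewrite lap_sum. Qed.

Lemma lapmx1 G : lapmx G *m kcol (fun=> 1) = 0.
Proof.
rewrite mul_lapmx_col; apply/colP=> i; rewrite !mxE.
by rewrite big1 // => v _; rewrite subrr mulr0.
Qed.

Lemma lap_quadratic G (f : G -> R) :
  ((kcol f)^T *m lapmx G *m kcol f) 0 0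
  = 2^-1 * \sum_u \sum_v (adj u v)%:R * (f u - f v) ^+ 2.
Proof.
rewrite -mulmxA mul_lapmx_col mul_kcol_tr.
have swap : \sum_u f u * (\sum_v (adj u v)%:R * (f u - f v))
  = \sum_u \sum_v (adj u v)%:R * (f v * (f v - f u)).
  rewrite exchange_big; apply: eq_bigr => u _; rewrite mulr_sumr.
  by apply: eq_bigr => v _; rewrite adj_sym mulrCA.
apply: (@mulrI _ 2); first by rewrite unitfE pnatr_eq0.
rewrite mulrA mulfV ?pnatr_eq0 // mul1r mulr_natl mulr2n {1}swap -big_split.
apply: eq_bigr => u _ /=; rewrite mulr_sumr -big_split.
by apply: eq_bigr => v _ /=; ring.
Qed.

Lemma lap_quadratic_ge0 G (f : G -> R) :
  0 <= ((kcol f)^T *m lapmx G *m kcol f) 0 0.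
Proof.
rewrite lap_quadratic mulr_ge0 ?invr_ge0 ?ler0n //.
by do 2!apply: sumr_ge0 => ? _; rewrite mulr_ge0 ?ler0n ?sqr_ge0.
Qed.

(** The quadratic form of the Laplacian is a sum of squares of differences along
    the edges, so a function in the kernel is constant along each edge. *)
Lemma lap_kernel G (f : G -> R) :
  connected G -> lapmx G *m kcol f = 0 -> forall u v, f u = f v.
Proof.
move=> connG Lf0.
have step u v : adj u v -> f u = f v.
  move=> uv; have := lap_quadratic f; rewrite -mulmxA Lf0 mulmx0 mxE.
  move/esym/eqP; rewrite mulf_eq0 invr_eq0 pnatr_eq0 /=.
  have ge0 x y : 0 <= (adj x y)%:R * (f x - f y) ^+ 2.
    by rewrite mulr_ge0 ?ler0n ?sqr_ge0.
  rewrite psumr_eq0 => [|x _]; last exact: sumr_ge0.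
  move=> /allP/(_ u (mem_index_enum _))/=; rewrite psumr_eq0 //.
  move=> /allP/(_ v (mem_index_enum _))/=.
  by rewrite uv mul1r sqrf_eq0 subr_eq0 => /eqP.
move=> u v; have /connectP[p pth ->] := connG u v.
elim: p u pth => //= w p IHp u /andP[uw /IHp <-]; exact: step.
Qed.

(** Each row of [1 - L S] annihilates the symmetric matrix [L] and is therefore
    constant. *)
Lemma lap_ginv_rows G (S : 'M[R]_#|G|) :
  connected G -> lapmx G *m S *m lapmx G = lapmx G ->
  forall i j j', (1%:M - lapmx G *m S) i j = (1%:M - lapmx G *m S) i j'.
Proof.
move=> connG LSL i j j'; set M := 1%:M - _.
have ML : M *m lapmx G = 0 by rewrite mulmxBl LSL mul1mx subrr.
pose f v := M i (enum_rank v).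
have Lf : lapmx G *m kcol f = 0.
  have -> : kcol f = (row i M)^T by apply/colP=> l; rewrite 3!mxE /f enum_valK.
  by rewrite -[lapmx G]lapmx_tr -trmx_mul -row_mul ML row0 trmx0.
have := lap_kernel connG Lf (enum_val j) (enum_val j').
by rewrite /f !enum_valK.
Qed.

(** This trace is the rank of [L].  Since [1 - L S] has constant rows, its trace
    is the sum of any of its columns, and this sum is 1 because the columns of
    [L] sum to 0. *)
Lemma trace_lap_ginv G (S : 'M[R]_#|G|) :
  connected G -> (0 < #|G|)%N -> lapmx G *m S *m lapmx G = lapmx G ->
  \tr (lapmx G *m S) = #|G|%:R - 1.
Proof.
move=> connG G_gt0 LSL; have rowsM := lap_ginv_rows connG LSL.
set M := 1%:M - _ in rowsM.
have -> : lapmx G *m S = 1%:M - M by rewrite subKr.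
rewrite raddfB /= mxtrace1; congr (_ - _).
pose j0 : 'I_#|G| := Ordinal G_gt0.
have -> : \tr M = ((kcol (fun=> 1))^T *m M) 0 j0.
  rewrite mxE; apply: eq_bigr => i _.
  by rewrite (rowsM i i j0) !mxE mul1r.
rewrite mulmxBr mulmx1 mulmxA -[lapmx G]lapmx_tr -trmx_mul lapmx1.
by rewrite trmx0 mul0mx subr0 !mxE.
Qed.

End Graph.

(** * Edges and degrees *)

Lemma set2_eq (T : finType) (a b c d : T) : a != b ->
  ([set c; d] == [set a; b]) = ((c, d) \in [:: (a, b); (b, a)]).
Proof.
move=> ab; rewrite !inE !xpair_eqE; apply/eqP/orP => [E|]; last first.
  by case=> /andP[/eqP-> /eqP->] //; rewrite setUC.
have /orP[/eqP ac|/eqP ad] : (a == c) || (a == d).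
- by rewrite -in_set2 E set21.
- have /orP[/eqP bc|/eqP->] : (b == c) || (b == d) by rewrite -in_set2 E set22.
    by rewrite ac bc eqxx in ab.
  by left; rewrite ac !eqxx.
- have /orP[/eqP->|/eqP bd] : (b == c) || (b == d) by rewrite -in_set2 E set22.
    by right; rewrite ad !eqxx.
  by rewrite ad bd eqxx in ab.
Qed.

(** Ordered pairs of adjacent vertices are counted in two ways: by their first
    component, and by the edge that they span, which two of them do. *)
Lemma handshake (G : sgraph) : (\sum_(u : G) degree u = 2 * #|edges G|)%N.
Proof.
have -> : (\sum_(u : G) degree u = \sum_(p : G * G | adj p.1 p.2) 1)%N.
  rewrite -(pair_big_dep xpredT (@adj G) (fun _ _ => 1%N)) /=.
  apply: eq_bigr => u _.
  by rewrite /degree -sum1_card; apply: eq_bigl => v; rewrite inE.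
rewrite (partition_big (fun p : G * G => [set p.1; p.2]) (mem (edges G))) /=.
  rewrite -sum1_card big_distrr /=; apply: eq_bigr => e /imsetP[[a b] /= ab ->].
  have a_neq_b : a != b.
    by apply: contraTneq ab => /= ->; rewrite inE /= adj_irr.
  rewrite sum1_card (@eq_card _ _ (mem [:: (a, b); (b, a)])).
    by rewrite (card_uniqP _) //= inE xpair_eqE (negPf a_neq_b).
  move=> [c d]; rewrite -(set2_eq c d a_neq_b) [LHS]inE /=; apply: andb_idl.
  by rewrite set2_eq // !inE => /orP[]/eqP[-> ->] //; rewrite adj_sym.
by move=> p pp; apply/imsetP; exists p.
Qed.

Lemma degree_gt0 (G : sgraph) (u : G) :
  connected G -> (0 < #|edges G|)%N -> (0 < degree u)%N.
Proof.
move=> connG /card_gt0P[_ /imsetP[[a b] /= ab _]].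
suff [v uv] : exists v, adj u v by apply/card_gt0P; exists v; rewrite inE.
have /connectP[[|v p] /=] := connG u a; last by case/andP=> uv _ _; exists v.
by move=> _ au; exists b; rewrite -au.
Qed.

(** * Kemeny's constant from a generalized inverse of the Laplacian *)

Section KemenyFormula.
Variable R : rcfType.

Definition vol (G : sgraph) : R := \sum_(u : G) deg R u.

Lemma vol_edges (G : sgraph) : vol G = 2 * #|edges G|%:R.
Proof. by rewrite -natrM -handshake natr_sum. Qed.

(** With [C = D^1/2], the normalized Laplacian is [C^-1 L C^-1], for which
    [C S C] is a generalized inverse; its kernel is spanned by [phi = C 1], of
    squared norm [vol G], and [Q] is the orthogonal projection onto it.  The two
    terms of the formula are the traces of [C S C] and of [C S C Q]. *)
Theorem kemeny_ginv (G : sgraph) (S : 'M[R]_#|G|) :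
  connected G -> (0 < #|edges G|)%N ->
  lapmx R G *m S *m lapmx R G = lapmx R G ->
  kemeny R G = \tr (degmx R G *m S)
    - (vol G)^-1 * ((kcol (@deg R G))^T *m S *m kcol (@deg R G)) 0 0.
Proof.
move=> connG edgeG LSL; set L := lapmx R G in LSL *.
pose q (u : G) : R := Num.sqrt (deg R u).
have q0 u : q u != 0.
  by rewrite sqrtr_eq0 -ltNge ltr0n degree_gt0.
have qq u : q u * q u = deg R u by rewrite -expr2 sqr_sqrtr ?ler0n.
have vol0 : vol G != 0.
  by rewrite vol_edges mulf_neq0 ?pnatr_eq0 -?lt0n.
pose B := kdiag (fun u => (q u)^-1); pose C := kdiag q.
have BC : B *m C = 1%:M by rewrite kdiagM kdiag1 // => u; rewrite mulVf.
have CB : C *m B = 1%:M by rewrite kdiagM kdiag1 // => u; rewrite mulfV.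
have CC : C *m C = degmx R G.
  by rewrite kdiagM; apply: eq_kmx => u v; rewrite qq.
have NLE : norm_laplacian R G = B *m L *m B.
  have -> : norm_laplacian R G = 1%:M - B *m kmx (fun u v => (adj u v)%:R) *m B.
    have BE : deg_inv_sqrt_mx R G = B.
      apply/matrixP=> i j; rewrite !mxE (inj_eq enum_val_inj).
      by case: eqP => _; rewrite ?mul1r ?mulr1n ?mul0r ?mulr0n.
    have AE : adj_mx R G = kmx (fun u v => (adj u v)%:R).
      by apply/matrixP=> i j; rewrite !mxE.
    by rewrite /norm_laplacian BE AE.
  have -> : L = C *m C - kmx (fun u v => (adj u v)%:R) by rewrite CC kmxB.
  by rewrite mulmxBr mulmxBl !mulmxA BC mul1mx CB.
pose phi := kcol q.
have phiE : phi = C *m kcol (fun=> 1).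
  by rewrite mul_kdiag_col; apply: eq_kcol => u; rewrite mulr1.
have Bphi : B *m phi = kcol (fun=> 1) by rewrite phiE mulmxA BC mul1mx.
have phi2 : phi^T *m phi = (vol G)%:M.
  apply/matrixP=> i j; rewrite !ord1 mul_kcol_tr mxE eqxx mulr1n.
  by apply: eq_bigr => u _.
have Lphi : norm_laplacian R G *m phi = 0.
  by rewrite NLE -(mulmxA _ B) Bphi -mulmxA lapmx1 mulmx0.
pose Q := (vol G)^-1 *: (phi *m phi^T).
have phiQ : phi^T *m (1%:M - Q) = 0.
  rewrite mulmxBr mulmx1 -scalemxAr mulmxA phi2 mul_scalar_mx.
  by rewrite scalerA mulVf // scale1r subrr.
have NLtr : (norm_laplacian R G)^T = norm_laplacian R G.
  by rewrite NLE !trmx_mul kdiag_tr lapmx_tr mulmxA.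
rewrite /kemeny (@sum_inv_eigenvalues R _ _ (C *m S *m C) Q
                   (C *m S *m C *m (1%:M - Q))) //.
- rewrite mulmxBr mulmx1 raddfB /=; congr (_ - _).
    by rewrite mxtrace_mulC mulmxA CC.
  rewrite -scalemxAr mxtraceZ mulmxA mxtrace_mulC -trace_mx11.
  have -> : kcol (@deg R G) = C *m phi.
    by rewrite mul_kdiag_col; apply: eq_kcol => u; rewrite qq.
  by rewrite trmx_mul kdiag_tr !mulmxA.
- move=> v; rewrite NLE.
  have -> : v *m (B *m L *m B) *m v^T = (B *m v^T)^T *m L *m (B *m v^T).
    by rewrite trmx_mul trmxK kdiag_tr !mulmxA.
  by rewrite [B *m v^T]kcolE lap_quadratic_ge0.
- apply/eigenvalueP; exists phi^T.
    by rewrite -{1}NLtr -trmx_mul Lphi trmx0 scale0r.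
  apply: contra_neq vol0 => phi0; have := phi2.
  by rewrite phi0 mul0mx => /matrixP/(_ 0 0); rewrite !mxE eqxx mulr1n.
- rewrite NLE; have -> : B *m L *m B *m (C *m S *m C) *m (B *m L *m B)
    = B *m (L *m (B *m C) *m S *m (C *m B) *m L) *m B by rewrite !mulmxA.
  by rewrite BC CB !mulmx1 LSL.
- by rewrite -scalemxAr mulmxA Lphi mul0mx scaler0.
(* What is left is 1 - Q = A W, where W is C S C (1 - Q): the rows of 1 - L S
   are multiples of the row of ones, and the latter times C is phi^T, which
   1 - Q annihilates. *)
pose M := 1%:M - L *m S.
have MC0 : M *m C *m (1%:M - Q) = 0.
  have rowsM := lap_ginv_rows connG LSL.
  have one l : (kcol (fun=> 1 : R))^T 0 l = 1 :> R by rewrite !mxE.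
  apply/matrixP=> i j; rewrite [RHS]mxE.
  have -> : (M *m C *m (1%:M - Q)) i j = M i i * (phi^T *m (1%:M - Q)) 0 j.
    rewrite -mulmxA phiE trmx_mul kdiag_tr -[in RHS]mulmxA.
    rewrite [LHS]mxE [X in _ = _ * X]mxE mulr_sumr.
    by apply: eq_bigr => l _; rewrite one mul1r (rowsM i l i).
  by rewrite phiQ [X in _ * X]mxE mulr0.
rewrite NLE; have -> : B *m L *m B *m (C *m S *m C *m (1%:M - Q))
  = B *m (L *m (B *m C) *m S) *m C *m (1%:M - Q) by rewrite !mulmxA.
have LS : L *m S = 1%:M - M by rewrite subKr.
rewrite BC mulmx1 LS.
by rewrite -!mulmxA mulmxBl mul1mx (mulmxA M) MC0 subr0 mulmxA BC mul1mx.
Qed.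

End KemenyFormula.

(** * Sums over the vertices of the hexagonal graph *)

Section Hexagonal.
Variables (R : rcfType) (k : nat) (G : sgraph).
Local Notation H := (hexagonal k G).
Implicit Types (u v w : G) (d e : dart G) (i j : 'I_k) (b c : bool).

Definition old u : H := inl u.
Definition new d i b : H := inr (d, i, b).

Lemma rev_dart_subproof d : adj (val d).2 (val d).1.
Proof. by rewrite adj_sym; case: d. Qed.

Definition rev_dart d : dart G :=
  exist _ ((val d).2, (val d).1) (rev_dart_subproof d).

Lemma rev_dartK : involutive rev_dart.
Proof. by move=> d; apply: val_inj; case: d => -[]. Qed.

Lemma is_revE d e : is_rev d e = (e == rev_dart d).
Proof. by []. Qed.

Lemma rev_dart_neq d : (d == rev_dart d) = false.
Proof.
apply/negP=> /eqP/(congr1 val)/(congr1 fst)/= d12.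
by have := svalP d; rewrite /= d12 adj_irr.
Qed.

Lemma big_hex (F : H -> R) :
  \sum_x F x = \sum_u F (old u)
    + \sum_(d : dart G) \sum_(i < k) (F (new d i false) + F (new d i true)).
Proof.
rewrite big_sumType /=; congr (_ + _).
rewrite (eq_bigr (fun p => F (new p.1.1 p.1.2 p.2))); last by case=> -[].
rewrite -(pair_bigA _ (fun p b => F (new p.1 p.2 b))) /=.
rewrite -(pair_bigA _ (fun d i => \sum_b F (new d i b))) /=.
by do 2![apply: eq_bigr => ? _]; rewrite big_bool addrC.
Qed.

Lemma big_dart (F : G -> G -> R) :
  \sum_(d : dart G) F (val d).1 (val d).2 = \sum_u \sum_v (adj u v)%:R * F u v.
Proof.
transitivity (\sum_(p : G * G | adj p.1 p.2) F p.1 p.2).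
  exact/esym/(big_sub (fun p : G * G => adj p.1 p.2) (fun p => F p.1 p.2)).
rewrite big_mkcond pair_bigA; apply: eq_bigr => -[u v] _ /=.
by case: adj; rewrite ?mul1r ?mul0r.
Qed.

Lemma big_rev_dart (F : dart G -> R) :
  \sum_(d : dart G) F (rev_dart d) = \sum_(d : dart G) F d.
Proof. by rewrite [RHS](reindex_inj (inv_inj rev_dartK)). Qed.

Lemma sum_adj_old u (F : H -> R) :
  \sum_y (adj (old u) y)%:R * F y = \sum_v (adj u v)%:R * F (old v)
    + \sum_(d : dart G) ((val d).1 == u)%:R * (\sum_(i < k) F (new d i false)).
Proof.
rewrite big_hex; congr (_ + _); apply: eq_bigr => d _.
by rewrite mulr_sumr; apply: eq_bigr => i _ /=; rewrite mul0r addr0.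
Qed.

Lemma sum_adj_false d i (F : H -> R) :
  \sum_y (adj (new d i false) y)%:R * F y
  = F (old (val d).1) + F (new d i true).
Proof.
rewrite big_hex; congr (_ + _).
  by apply: sum_natl => u; rewrite /= eq_sym.
rewrite (bigD1 d) //= (bigD1 i) //= !eqxx /= mul0r add0r mul1r.
rewrite !big1 ?addr0 // => [e /negPf ed|j /negPf ji].
  apply: big1 => j _; rewrite (eq_sym d) ed /=.
  by rewrite !andbF !mul0r addr0.
by rewrite (eq_sym i) ji /= !mul0r addr0.
Qed.

Lemma sum_adj_true d i (F : H -> R) :
  \sum_y (adj (new d i true) y)%:R * F y
  = F (new d i false) + F (new (rev_dart d) i true).
Proof.
rewrite big_hex big1 ?add0r => [|u _]; last by rewrite mul0r.
transitivity (\sum_(e : dart G) ((d == e)%:R * F (new e i false)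
  + (rev_dart d == e)%:R * F (new e i true))); last first.
  by rewrite big_split !sum_delta.
apply: eq_bigr => e _; rewrite (bigD1 i) //= big1 ?addr0 => [|j /negPf ji].
  rewrite eqxx /= !andbT !andbF orbF orFb is_revE (eq_sym (rev_dart d)).
  by rewrite /= ?orbF.
by rewrite (eq_sym i) ji /= !mul0r addr0.
Qed.

Lemma sum_out_dart u (F : G -> G -> R) :
  \sum_(d : dart G) ((val d).1 == u)%:R * F (val d).1 (val d).2
  = \sum_v (adj u v)%:R * F u v.
Proof.
rewrite (big_dart (fun v w => (v == u)%:R * F v w)) (bigD1 u) //=.
rewrite [X in _ + X]big1 ?addr0 => [|v /negPf vu].
  by apply: eq_bigr => v _; rewrite eqxx mul1r.
by apply: big1 => w _; rewrite vu mul0r mulr0.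
Qed.

Lemma deg_old u : deg R (old u) = (1 + k%:R) * deg R u.
Proof.
rewrite degE; under eq_bigr do rewrite -[_%:R]mulr1.
rewrite (sum_adj_old u (fun=> 1)) (sum_out_dart u (fun _ _ => \sum_(i < k) 1)).
rewrite -!mulr_suml -degE sumr_const card_ord; ring.
Qed.

Lemma deg_new d i b : deg R (new d i b) = 2.
Proof.
rewrite degE; under eq_bigr do rewrite -[_%:R]mulr1.
case: b; first exact: (sum_adj_true d i (fun=> 1)).
exact: (sum_adj_false d i (fun=> 1)).
Qed.

Lemma vol_dart : vol R G = \sum_(d : dart G) 1.
Proof.
rewrite (big_dart (fun _ _ => 1)); apply: eq_bigr => u _; rewrite degE.
by apply: eq_bigr => v _; rewrite mulr1.
Qed.

Lemma vol_hex : vol R H = (5 * k%:R + 1) * vol R G.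
Proof.
rewrite {1}/vol big_hex; under eq_bigr do rewrite deg_old.
rewrite -mulr_sumr -/(vol R G).
have -> : \sum_(d : dart G) \sum_(i < k)
      (deg R (new d i false) + deg R (new d i true))
    = (2 + 2) * k%:R * \sum_(d : dart G) 1.
  rewrite mulr_sumr; apply: eq_bigr => d _.
  under eq_bigr do rewrite !deg_new.
  by rewrite sumr_const card_ord mulr1 mulr_natr.
by rewrite -vol_dart; ring.
Qed.

(** * Harmonic extension and Green function of the new paths *)

(** The weight of the near end of a path of length 5 at distance 1 ([false]) and
    2 ([true]) from it. *)
Definition near_weight b : R := if b then 3 / 5 else 4 / 5.

(** As a function of [x] this is harmonic at the new vertices, and on the old
    ones it is the indicator of [w]. *)
Definition harmonic (x : H) w : R :=
  match x with
  | inl u => (u == w)%:R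
  | inr (d, _, b) => near_weight b * ((val d).1 == w)%:R
                     + (1 - near_weight b) * ((val d).2 == w)%:R
  end.

(** The Green function of a path with vertices 0, ..., 5 grounded at its ends is
    [p (5 - q) / 5] at interior positions [p <= q].  A dart numbers positions
    from its origin, so [false] and [true] stand for 1 and 2; a vertex attached
    to the reverse dart of the same edge is at position 4 or 3. *)
Definition green_near b c : R :=
  if b == c then (if b then 6 / 5 else 4 / 5) else 3 / 5.

Definition green_far b c : R :=
  if b == c then (if b then 4 / 5 else 1 / 5) else 2 / 5.

Definition path_green (x y : H) : R :=
  match x, y with
  | inr (d, i, b), inr (e, j, c) =>
      (i == j)%:R * ((d == e)%:R * green_near b c
                     + (rev_dart d == e)%:R * green_far b c)
  | _, _ => 0
  end.

Definition old_incl (x : H) w : R := if x is inl u then (u == w)%:R else 0.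

Lemma mul_incl (T : finType) (F : G -> T -> R) :
  kmx old_incl *m kmx F = kmx (fun x t => if x is inl u then F u t else 0).
Proof.
rewrite mul_kmx; apply: eq_kmx => -[u|p] t /=; first by rewrite sum_delta.
by rewrite big1 // => v _; rewrite mul0r.
Qed.

(** Being harmonic, the extension has zero Laplacian at the new vertices; at an
    old one each edge of [G] carries its own current and that of [k] parallel
    paths of conductance 1/5. *)
Lemma lap_harm :
  lapmx R H *m kmx harmonic = (1 + k%:R / 5) *: (kmx old_incl *m lapmx R G).
Proof.
rewrite mul_lapmx mul_incl kmxZ; apply: eq_kmx => -[u|[[d i] b]] w.
- rewrite -(sum_deltar w (fun v => (u == v)%:R * deg R u - (adj u v)%:R)).
  rewrite lap_sum.
  rewrite (sum_adj_old u (fun y => harmonic (old u) w - harmonic y w)).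
  rewrite (sum_out_dart u (fun a a' => \sum_(i < k) ((u == w)%:R
    - (4 / 5 * (a == w)%:R + (1 - 4 / 5) * (a' == w)%:R)))) /=.
  under [X in _ + X]eq_bigr do rewrite sumr_const card_ord -mulr_natr.
  by rewrite mulr_sumr -big_split; apply: eq_bigr => v _ /=; field.
- case: b; rewrite mulr0.
    rewrite (sum_adj_true d i
      (fun y => harmonic (new d i true) w - harmonic y w)) /=.
    by field.
  rewrite (sum_adj_false d i
    (fun y => harmonic (new d i false) w - harmonic y w)) /=.
  by field.
Qed.

(** At the new vertices this is the defining property of a Green function.  At
    an old vertex the Laplacian is minus the current that reaches it from a unit
    source on a path, and by reciprocity this current is the harmonic weight of
    that vertex at the source. *)
Lemma lap_green :
  lapmx R H *m kmx path_green = 1%:M - kmx old_incl *m (kmx harmonic)^T.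
Proof.
rewrite mul_lapmx tr_kmx mul_incl -kmx1 kmxB; apply: eq_kmx => x y.
case: x => [u|[[d i] b]].
- rewrite (sum_adj_old u (fun x => path_green (old u) y - path_green x y)) /=.
  rewrite subrr.
  rewrite big1 ?add0r => [|v _]; last by rewrite mulr0.
  case: y => [v|[[e j] c]].
    have -> : (inl u == inl v :> H) = (v == u) by rewrite [RHS]eq_sym.
    rewrite /= [RHS]subrr big1 // => d _.
    by rewrite big1 ?mulr0 // => i _; rewrite subrr.
  rewrite /= sub0r.
  transitivity (- \sum_(d : dart G)
    ((d == e)%:R * ((val d).1 == u)%:R * green_near false c
    + (rev_dart d == e)%:R * ((val d).1 == u)%:R * green_far false c)).
    rewrite -sumrN; apply: eq_bigr => d _.
    under eq_bigr do rewrite sub0r mulrC -mulNr.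
    by rewrite sum_deltar; ring.
  rewrite big_split /=; congr (- _).
  under eq_bigr do rewrite -mulrA; rewrite (sum_natl (x := e)) //.
  under [X in _ + X]eq_bigr do rewrite -mulrA.
  rewrite (sum_natl (x := rev_dart e)) /=; last first.
    by move=> d; rewrite (can2_eq rev_dartK rev_dartK).
  rewrite mulrC [X in _ + X]mulrC /green_near /green_far /near_weight.
  by congr (_ * _ + _ * _); case: c; field.
- have pairE e j c c' : (inr (d, i, c') == inr (e, j, c) :> H)%:R
      = [&& i == j, d == e & c' == c]%:R :> R.
    by rewrite andbCA andbA -!xpair_eqE.
  rewrite subr0; case: b.
    rewrite (sum_adj_true d i
      (fun x => path_green (new d i true) y - path_green x y)).
    case: y => [v|[[e j] c]] /=; first by rewrite subrr addr0.
    rewrite [RHS]pairE rev_dartK /green_near /green_far.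
    case: (i == j); case: (d == e); case: (rev_dart d == e); case: c => /=;
      by field.
  rewrite (sum_adj_false d i
    (fun x => path_green (new d i false) y - path_green x y)).
  case: y => [v|[[e j] c]] /=; first by rewrite subrr addr0.
  rewrite [RHS]pairE /green_near /green_far.
  case: (i == j); case: (d == e); case: (rev_dart d == e); case: c => /=;
    by field.
Qed.

(** With [r = 1 + k/5], transposing [L_H T = r J L] gives
    [T^T L_H = r L J^T].  Hence the Green function contributes
    [L_H - r J L J^T] and the other term restores
    [r J L S L J^T = r J L J^T]. *)
Lemma ginv_hex (S : 'M[R]_#|G|) :
  lapmx R G *m S *m lapmx R G = lapmx R G ->
  lapmx R H *m (kmx path_green
      + (1 + k%:R / 5)^-1 *: (kmx harmonic *m S *m (kmx harmonic)^T))
    *m lapmx R H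
  = lapmx R H.
Proof.
move=> LSL; set r := 1 + k%:R / 5; set T := kmx harmonic; set J := kmx old_incl.
have r0 : r != 0 by rewrite lt0r_neq0 // ltr_pwDl ?divr_ge0 ?ler0n.
have LT : lapmx R H *m T = r *: (J *m lapmx R G) by exact: lap_harm.
have TL : T^T *m lapmx R H = r *: (lapmx R G *m J^T).
  by rewrite -[lapmx R H]lapmx_tr -trmx_mul LT linearZ /= trmx_mul lapmx_tr.
have near : lapmx R H *m kmx path_green *m lapmx R H
    = lapmx R H - r *: (J *m lapmx R G *m J^T).
  rewrite lap_green -/T -/J mulmxBl mul1mx -(mulmxA J (T^T)) TL.
  by rewrite -scalemxAr mulmxA.
have far : lapmx R H *m (r^-1 *: (T *m S *m T^T)) *m lapmx R H
    = r *: (J *m lapmx R G *m J^T).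
  rewrite -scalemxAr -scalemxAl !mulmxA LT -!scalemxAl scalerA mulVf // scale1r.
  rewrite -(mulmxA _ T^T) TL -scalemxAr; congr (_ *: _).
  by rewrite !mulmxA -(mulmxA J _ S) -(mulmxA J (_ *m S)) LSL.
by rewrite mulmxDr mulmxDl near far subrK.
Qed.

Lemma sum_in_dart u (F : G -> G -> R) :
  \sum_(d : dart G) ((val d).2 == u)%:R * F (val d).1 (val d).2
  = \sum_v (adj u v)%:R * F v u.
Proof.
by rewrite -big_rev_dart; exact: (sum_out_dart u (fun v w => F w v)).
Qed.

Lemma sum_const_dart (x : R) :
  \sum_(d : dart G) \sum_(i < k) x = k%:R * vol R G * x.
Proof.
rewrite vol_dart mulrAC mulr_sumr; apply: eq_bigr => d _.
by rewrite sumr_const card_ord mulr1 mulr_natl.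
Qed.

(** * Traces along the new paths *)

Lemma trace_green : \tr (degmx R H *m kmx path_green) = 4 * k%:R * vol R G.
Proof.
rewrite [degmx R H *m _]mul_kdiag_l mxtrace_kmx big_hex.
rewrite big1 ?add0r => [|u _]; last by rewrite mulr0.
(* Each half-path contributes 2 (4/5 + 6/5): degree times diagonal entries. *)
transitivity (\sum_(d : dart G) \sum_(i < k) (4 : R)).
  apply: eq_bigr => d _; apply: eq_bigr => i _.
  rewrite !deg_new /= !eqxx [rev_dart d == d]eq_sym rev_dart_neq.
  by rewrite /green_near /=; field.
by rewrite sum_const_dart; ring.
Qed.

(** Sources of strength 2 at all interior vertices of a path give at position
    [p] the potential [p (5 - p)]: 4 at distance 1 from an end, 6 at
    distance 2. *)
Lemma green_deg :
  kmx path_green *m kcol (@deg R H)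
  = kcol (fun x : H => if x is inr (_, _, b) then if b then 6 else 4 else 0).
Proof.
rewrite mul_kmx_col; apply: eq_kcol => -[u|[[d i] b]]; rewrite big_hex /=.
  rewrite !big1 ?addr0 // => [d _|v _]; last by rewrite mul0r.
  by rewrite big1 // => i _; rewrite !mul0r addr0.
rewrite big1 ?add0r => [|v _]; last by rewrite mul0r.
transitivity (\sum_(e : dart G)
  ((d == e)%:R * (2 * (green_near b false + green_near b true))
   + (rev_dart d == e)%:R * (2 * (green_far b false + green_far b true)))).
  apply: eq_bigr => e _; under eq_bigr do rewrite !deg_new -!mulrA -mulrDr.
  by rewrite sum_delta; ring.
rewrite big_split !sum_delta /green_near /green_far.
by case: b => /=; field.
Qed.

Lemma quad_green :
  ((kcol (@deg R H))^T *m kmx path_green *m kcol (@deg R H)) 0 0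
  = 20 * k%:R * vol R G.
Proof.
rewrite -mulmxA green_deg mul_kcol_tr big_hex.
rewrite big1 ?add0r => [|u _]; last by rewrite mulr0.
(* Each half-path contributes 2 * 4 + 2 * 6. *)
transitivity (\sum_(d : dart G) \sum_(i < k) (20 : R)).
  by apply: eq_bigr => d _; apply: eq_bigr => i _; rewrite !deg_new; ring.
by rewrite sum_const_dart; ring.
Qed.

Lemma harm_deg :
  (kmx harmonic)^T *m kcol (@deg R H) = (5 * k%:R + 1) *: kcol (@deg R G).
Proof.
rewrite tr_kmx mul_kmx_col kcolZ; apply: eq_kcol => u; rewrite big_hex.
under eq_bigr do rewrite /= deg_old mulrC; rewrite sum_deltar.
transitivity ((1 + k%:R) * deg R u + k%:R * \sum_(d : dart G)
  (14 / 5 * (((val d).1 == u)%:R * 1) + 6 / 5 * (((val d).2 == u)%:R * 1))).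
  congr (_ + _); rewrite mulr_sumr; apply: eq_bigr => d _.
  under eq_bigr do rewrite !deg_new /=.
  by rewrite sumr_const card_ord -[_ *+ k]mulr_natl; field.
rewrite big_split /= -!mulr_sumr (sum_out_dart u (fun _ _ => 1)).
rewrite (sum_in_dart u (fun _ _ => 1)).
have -> : \sum_v (adj u v)%:R * 1 = deg R u.
  by rewrite degE; apply: eq_bigr => v _; rewrite mulr1.
by field.
Qed.

(** On one path the squared weights sum to [30 / 25] for either end and the
    mixed ones to [20 / 25], and every interior vertex has degree 2.  Summing
    over the paths leaves [(17 k / 5 + 1) D + (8 k / 5) A], which is rewritten
    with [A = D - L]. *)
Lemma harm_gram :
  (kmx harmonic)^T *m degmx R H *m kmx harmonic
  = (5 * k%:R + 1) *: degmx R G - (8 * k%:R / 5) *: lapmx R G.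
Proof.
rewrite -mulmxA [degmx R H *m _]mul_kdiag_l tr_kmx mul_kmx !kmxZ kmxB.
apply: eq_kmx => u w; rewrite big_hex.
under eq_bigr do rewrite /= deg_old mulrC; rewrite sum_deltar.
(* The products of weights are summed over the two vertices of a half-path, at
   distances 1 and 2 from the origin of the dart: 16 + 9 for the origin,
   4 + 6 mixed, 1 + 4 for the other end, all over 25. *)
transitivity ((1 + k%:R) * deg R u * (u == w)%:R + k%:R * \sum_(d : dart G)
  (((val d).1 == u)%:R
     * (2 * (25 / 25 * ((val d).1 == w)%:R + 10 / 25 * ((val d).2 == w)%:R))
   + ((val d).2 == u)%:R
     * (2 * (10 / 25 * ((val d).1 == w)%:R + 5 / 25 * ((val d).2 == w)%:R)))).
  congr (_ + _); rewrite mulr_sumr; apply: eq_bigr => d _.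
  under eq_bigr do rewrite !deg_new /=.
  by rewrite sumr_const card_ord -[_ *+ k]mulr_natl; field.
rewrite big_split /=.
rewrite (sum_out_dart u (fun x y =>
  2 * (25 / 25 * (x == w)%:R + 10 / 25 * (y == w)%:R))).
rewrite (sum_in_dart u (fun x y =>
  2 * (10 / 25 * (x == w)%:R + 5 / 25 * (y == w)%:R))).
rewrite -big_split /=.
transitivity ((1 + k%:R) * deg R u * (u == w)%:R + k%:R *
  (12 / 5 * (u == w)%:R * (\sum_v (adj u v)%:R)
   + 8 / 5 * (\sum_v (adj u v)%:R * (v == w)%:R))).
  congr (_ + _ * _); rewrite !mulr_sumr -big_split; apply: eq_bigr => v _ /=.
  by field.
by rewrite -degE (sum_deltar w (fun v => (adj u v)%:R)); field.
Qed.

End Hexagonal.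

(** * Kemeny's constant of the hexagonal graphs *)

Section Iteration.
Variables (R : rcfType) (k : nat).
Local Notation kR := (k%:R : R).

Lemma connected_hex (G : sgraph) : connected G -> connected (hexagonal k G).
Proof.
move=> connG; set H := hexagonal k G.
have symH : connect_sym (@adj H) by apply/sym_connect_sym/adj_sym.
have old_old (u v : G) : connect (@adj H) (old k u) (old k v).
  have /connectP[p pth ->] := connG u v.
  elim: p u pth => [|w p IHp] u /=; first by move=> _; exact: connect0.
  by case/andP=> uw /IHp; apply: connect_trans; apply: connect1.
have to_old (x : H) : exists u, connect (@adj H) x (old k u).
  case: x => [u|[[d i] b]]; first by exists u; exact: connect0.
  have near : connect (@adj H) (new d i false) (old k (val d).1).
    by apply: connect1; rewrite /= eqxx.
  exists (val d).1; case: b; last exact: near.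
  by apply: connect_trans near; apply: connect1; rewrite /= !eqxx.
move=> x y; have [u xu] := to_old x; have [v yv] := to_old y.
by apply: connect_trans xu (connect_trans (old_old u v) _); rewrite symH.
Qed.

Lemma edges_hex (G : sgraph) :
  #|edges (hexagonal k G)|%:R = (5 * kR + 1) * #|edges G|%:R.
Proof.
apply: (@mulrI _ 2); first by rewrite unitfE pnatr_eq0.
by rewrite -vol_edges vol_hex vol_edges mulrCA.
Qed.

Lemma card_hex (G : sgraph) :
  #|hexagonal k G|%:R = #|G|%:R + 4 * kR * #|edges G|%:R.
Proof.
have card_sum1 (T : finType) : #|T|%:R = \sum_(x : T) (1 : R).
  by rewrite sumr_const.
rewrite !card_sum1 big_hex sum_const_dart vol_edges; ring.
Qed.

Lemma card_edges_hex_gt0 (G : sgraph) :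
  (0 < #|edges G|)%N -> (0 < #|edges (hexagonal k G)|)%N.
Proof.
rewrite -!(ltr0n R) edges_hex => E0; rewrite mulr_gt0 //.
by rewrite ltr_wpDl ?mulr_ge0 ?ler0n.
Qed.

(** The generalized inverse of [ginv_hex] enters [kemeny_ginv] only through a
    trace and a quadratic form, which reduce to those of [S] for [G].  The term
    in [N - 1] is the trace of [L S] produced by [harm_gram], and the last one
    is [40 k E] over the volume [2 (5 k + 1) E]. *)
Theorem kemeny_hex (G : sgraph) :
  connected G -> (0 < #|edges G|)%N ->
  kemeny R (hexagonal k G)
  = 5 * (5 * kR + 1) / (kR + 5) * kemeny R G + 8 * kR * #|edges G|%:R
    - 8 * kR / (kR + 5) * (#|G|%:R - 1) - 20 * kR / (5 * kR + 1).
Proof.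
move=> connG edgeG.
have [S LSL] : exists S, lapmx R G *m S *m lapmx R G = lapmx R G.
  by exists (pinvmx (lapmx R G)); rewrite mulmxKpV.
have G_gt0 : (0 < #|G|)%N.
  have /card_gt0P[_ /imsetP[[a b] _ _]] := edgeG.
  by apply/card_gt0P; exists a.
rewrite (kemeny_ginv (connected_hex connG) (card_edges_hex_gt0 edgeG)
           (ginv_hex k LSL)).
rewrite (kemeny_ginv connG edgeG LSL).
set c := (1 + kR / 5)^-1; set T := kmx (@harmonic R k G).
rewrite mulmxDr raddfD /= trace_green -scalemxAr mxtraceZ.
have -> : \tr (degmx R (hexagonal k G) *m (T *m S *m T^T))
  = (5 * kR + 1) * \tr (degmx R G *m S) - 8 * kR / 5 * (#|G|%:R - 1).
  rewrite -(trace_lap_ginv connG G_gt0 LSL) !mulmxA mxtrace_mulC !mulmxA.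
  by rewrite harm_gram mulmxBl -!scalemxAl raddfB /= !mxtraceZ.
have -> : ((kcol (@deg R (hexagonal k G)))^T *m
    (kmx (@path_green R k G) + c *: (T *m S *m T^T))
    *m kcol (@deg R (hexagonal k G))) 0 0
  = 20 * kR * vol R G + c * ((5 * kR + 1) ^+ 2
      * ((kcol (@deg R G))^T *m S *m kcol (@deg R G)) 0 0).
  rewrite mulmxDr mulmxDl mxE quad_green -scalemxAr -scalemxAl; congr (_ + _).
  have Td : T^T *m kcol (@deg R (hexagonal k G))
      = (5 * kR + 1) *: kcol (@deg R G).
    exact: harm_deg.
  have dT : (kcol (@deg R (hexagonal k G)))^T *m T
      = (5 * kR + 1) *: (kcol (@deg R G))^T.
    by rewrite -[T]trmxK -trmx_mul Td linearZ.
  rewrite mxE; congr (_ * _); set d := kcol _ in Td dT *.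
  have -> : d^T *m (T *m S *m T^T) *m d = (d^T *m T) *m S *m (T^T *m d).
    by rewrite !mulmxA.
  by rewrite dT Td -!scalemxAl -scalemxAr scalerA mxE.
rewrite vol_hex vol_edges.
set tr := \tr _; set q := (_ *m _) 0 0.
set E := #|edges G|%:R; set N := #|G|%:R.
have E0 : E != 0 :> R by rewrite pnatr_eq0 -lt0n.
have k5 : kR + 5 != 0 by rewrite lt0r_neq0 // ltr_wpDl ?ler0n.
have k1 : 5 * kR + 1 != 0 by rewrite lt0r_neq0 // ltr_wpDl ?mulr_ge0 ?ler0n.
rewrite /c; field.
by rewrite E0 k5 k1.
Qed.

Lemma hexagonal_iterP (G : sgraph) (n : nat) :
  connected G -> (0 < #|edges G|)%N ->
  [/\ connected (hexagonal_iter k n G), (0 < #|edges (hexagonal_iter k n G)|)%N,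
      #|edges (hexagonal_iter k n G)|%:R = (5 * kR + 1) ^+ n * #|edges G|%:R
    & #|hexagonal_iter k n G|%:R
      = #|G|%:R + 4 / 5 * ((5 * kR + 1) ^+ n - 1) * #|edges G|%:R].
Proof.
move=> connG edgeG; elim: n => [|n [IHc IHe IHE IHN]].
  by split=> //; rewrite expr0 ?mul1r // subrr mulr0 mul0r addr0.
split; [exact: connected_hex | exact: card_edges_hex_gt0 | |].
  by rewrite edges_hex IHE mulrA -exprS.
by rewrite card_hex IHN IHE exprS; field.
Qed.

End Iteration.

Theorem theorem3p4 (R : rcfType) (G : sgraph) (k n : nat)
    (connG : connected G) (edgeG : (1 <= #|edges G|)%N)
    (k_ge2 : (2 <= k)%N) (n_ge1 : (1 <= n)%N) :
  let kR := k%:R : R in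
  let N0 := #|G|%:R : R in
  let E0 := #|edges G|%:R : R in
  let mu := (kR + 5) / (24 * kR) * ((5 * (5 * kR + 1) / (kR + 5)) ^+ n - 1) in
  let eta := - ((kR + 5) / kR) * ((5 / (kR + 5)) ^+ n - 1) in
  kemeny R (hexagonal_iter k n G) =
    (25 * kR + 5) / (kR + 5) * kemeny R (hexagonal_iter k n.-1 G)
    + (8 * kR * (5 * kR + 21) / (5 * (kR + 5)) * (5 * kR + 1) ^+ n.-1
       + 32 * kR / (5 * (kR + 5))) * E0
    - 8 * kR / (kR + 5) * N0
    + 4 * (5 * kR ^+ 2 - 23 * kR) / ((kR + 5) * (5 * kR + 1))
  /\
  kemeny R (hexagonal_iter k n G) =
    ((25 * kR + 5) / (kR + 5)) ^+ n * kemeny R G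
    + (8 * kR * (5 * kR + 21) * eta / (5 * (kR + 5)) * (5 * kR + 1) ^+ n.-1
       + 32 * kR * mu / (5 * (kR + 5))) * E0
    - 8 * kR * mu / (kR + 5) * N0
    + 4 * (5 * kR ^+ 2 - 23 * kR) * mu / ((kR + 5) * (5 * kR + 1)).
Proof.
move=> kR N0 E0.
have k0 : kR != 0 by rewrite pnatr_eq0 -lt0n (ltn_trans _ k_ge2).
have k5 : kR + 5 != 0 by rewrite lt0r_neq0 // ltr_wpDl ?ler0n.
have k1 : 5 * kR + 1 != 0 by rewrite lt0r_neq0 // ltr_wpDl ?mulr_ge0 ?ler0n.
have step m : kemeny R (hexagonal_iter k m.+1 G) =
    (25 * kR + 5) / (kR + 5) * kemeny R (hexagonal_iter k m G)
    + (8 * kR * (5 * kR + 21) / (5 * (kR + 5)) * (5 * kR + 1) ^+ m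
       + 32 * kR / (5 * (kR + 5))) * E0
    - 8 * kR / (kR + 5) * N0
    + 4 * (5 * kR ^+ 2 - 23 * kR) / ((kR + 5) * (5 * kR + 1)).
  have [cm em Em Nm] := hexagonal_iterP R k m connG edgeG.
  rewrite [hexagonal_iter k m.+1 G]/= kemeny_hex // Em Nm -/kR -/N0 -/E0.
  by field; rewrite k5 k1.
case: n n_ge1 => // n _; split; first exact: step.
elim: n => [|n IHn].
  by rewrite step /= !expr1 expr0; field; rewrite k0 k5 k1.
rewrite step IHn /= !exprS.
have -> : 5 * (5 * kR + 1) / (kR + 5) = 5 / (kR + 5) * (5 * kR + 1).
  by ring.
have -> : (25 * kR + 5) / (kR + 5) = 5 / (kR + 5) * (5 * kR + 1) by field.
(* Split the powers into s = (5 / (k + 5))^n and p = (5 k + 1)^n: the identity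
   is then rational in k, s and p. *)
rewrite !(exprMn _ (5 / (kR + 5))).
set s := (5 / _) ^+ n; set p := (5 * kR + 1) ^+ n; set K := kemeny _ _.
by field; rewrite k0 k5 k1.
Qed.
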